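(* Let $\ell\geq 4$ be an integer with $\ell\not\equiv 2 \pmod 4$. For every $\varepsilon>0$ there exists $n_0$ such that every tournament $T$ on $n\geq n_0$ vertices with $t(C_3,T)\geq \frac18-\frac{1}{10\ell^2}$ satisfies $$t(C_\ell,T)\geq g_\ell\big(t(C_3,T)\big)-\varepsilon.$$ (Equivalently, $t(C_\ell,T)\geq g_\ell(t(C_3,T))+o(1)$, where $o(1)\to 0$ as $|V(T)|\to\infty$.)
   Context: For a tournament $T$ and $\ell\geq 3$, $C_\ell$ is the directed cycle of length $\ell$, and $t(C_\ell,T)$ is the number of homomorphisms of $C_\ell$ to $T$ (maps $V(C_\ell)\to V(T)$ sending arcs to arcs) divided by $|V(T)|^\ell$. For an integer $\ell\geq 4$, the function $g_\ell:[0,1/8]\to[0,1]$ is defined by $g_\ell(0)=0$ and, for every real $z\in(0,1]$, $$g_\ell\Big(\tfrac18\big(\lfloor z^{-1}\rfloor z^3+(1-\lfloor z^{-1}\rfloor z)^3\big)\Big)=\tfrac{1}{2^\ell}\big(\lfloor z^{-1}\rfloor z^\ell+(1-\lfloor z^{-1}\rfloor z)^\ell\big);$$ this is well defined since $z\mapsto \lfloor z^{-1}\rfloor z^3+(1-\lfloor z^{-1}\rfloor z)^3$ is a strictly increasing continuous bijection from $(0,1]$ onto $(0,1]$. *)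

(* Defs.v *)
From mathcomp Require Import all_boot all_order all_algebra.
From mathcomp Require Import boolp classical_sets reals.
From mathcomp Require Import ring lra.

Set Implicit Arguments.
Unset Strict Implicit.
Unset Printing Implicit Defensive.

Import Order.TTheory GRing.Theory Num.Theory.
Local Open Scope ring_scope.

Definition tournament (V : finType) (e : rel V) : Prop :=
  irreflexive e /\ forall x y : V, x != y -> e x y (+) e y x.

(* C_l has vertex set 'I_l and arcs i -> ordS i, i.e. i -> i + 1 mod l. *)
Definition cycle_homs (l : nat) (V : finType) (e : rel V) :
    {set {ffun 'I_l -> V}} :=
  [set f : {ffun 'I_l -> V} | [forall i : 'I_l, e (f i) (f (ordS i))]].

Definition cycle_density (R : realType) (l : nat) (V : finType) (e : rel V)
    : R :=
  #|cycle_homs l e|%:R / #|V|%:R ^+ l.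

Definition blocks (R : realType) (l : nat) (z : R) : R :=
  (Num.floor z^-1)%:~R * z ^+ l + (1 - (Num.floor z^-1)%:~R * z) ^+ l.

(* For 0 < x <= 1/8 the chosen z in (0, 1] exists and is unique, so this is
   the function with g_fun l 0 = 0 and
   g_fun l (blocks 3 z / 8) = blocks l z / 2 ^ l for all z in (0, 1];
   see g_funE and blocks3_surj below. Outside [0, 1/8] the value is junk. *)
Definition g_fun (R : realType) (l : nat) (x : R) : R :=
  if x == 0 then 0
  else (2 ^+ l)^-1 *
    blocks l (xget 0 [set z : R | 0 < z <= 1 /\ 8^-1 * blocks 3 z = x]%classic).

Definition block3 (R : realType) (k z : R) : R := k * z ^+ 3 + (1 - k * z) ^+ 3.

Lemma block3_mono (R : realType) (k z z' : R) : 0 < k -> z < z' -> 1 <= (k + 1) * z -> k * z' <= 1 ->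
  block3 k z < block3 k z'.
Proof.
move=> k0 zz' hz hz'.
have -> : block3 k z' = block3 k z + k * (z' - z) * ((z' ^+ 2 + z * z' + z ^+ 2)
  - ((1 - k * z) ^+ 2 + (1 - k * z) * (1 - k * z') + (1 - k * z') ^+ 2)).
  by rewrite /block3; ring.
rewrite ltrDl; apply: mulr_gt0; first by apply: mulr_gt0 => //; lra.
have kzz' : k * z < k * z' by rewrite ltr_pM2l.
have w0 : 0 <= 1 - k * z by lra.
have w'0 : 0 <= 1 - k * z' by lra.
have wz : 1 - k * z <= z by lra.
have wz' : 1 - k * z' < z' by lra.
rewrite subr_gt0; apply: ltr_leD; first apply: ler_ltD.
all: nra.
Qed.

Lemma block3V (R : realType) (k : R) : 0 < k -> block3 k k^-1 = k^-1 ^+ 2.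
Proof. by move=> k0; rewrite /block3; field; rewrite gt_eqF. Qed.

Lemma block3V1 (R : realType) (k : R) : 0 < k ->
  block3 k (k + 1)^-1 = (k + 1)^-1 ^+ 2.
Proof.
move=> k0; have k10 : 0 < k + 1 by lra.
by rewrite /block3; field; rewrite gt_eqF.
Qed.

Lemma floorinv (R : realType) (z : R) : 0 < z <= 1 -> exists2 n : nat, Num.floor z^-1 = n%:Z :> int &
  [/\ (0 < n)%N, n%:R * z <= 1 & 1 < (n%:R + 1) * z].
Proof.
move=> /andP[z0 z1].
have [n nE] : exists n : nat, Num.floor z^-1 = n%:Z :> int.
  have : 0 <= Num.floor z^-1 by rewrite floor_ge0 invr_ge0 ltW.
  by case: (Num.floor _) => // n _; exists n.
exists n => //; have := floor_itv z^-1; rewrite nE rmorphD /= => /andP[h1 h2].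
split; last by rewrite -ltr_pdivrMr// div1r.
  2: by rewrite -ler_pdivlMr// div1r.
have : 1 <= Num.floor z^-1 by rewrite floor_ge_int invf_ge1.
by rewrite nE.
Qed.

Lemma blocks3_mono (R : realType) (z z' : R) : 0 < z -> z < z' -> z' <= 1 ->
  blocks 3 z < blocks 3 z'.
Proof.
move=> z0 zz' z'1.
have z01 : 0 < z <= 1 by rewrite z0/= ltW// (lt_le_trans zz').
have z'01 : 0 < z' <= 1 by rewrite (lt_trans z0 zz').
have [n nE [n0 n1 n2]] := floorinv z01.
have [m mE [m0 m1 m2]] := floorinv z'01.
rewrite /blocks nE mE -/(block3 _ _) -[ltRHS]/(block3 m%:R z').
have n0' : 0 < n%:R :> R by rewrite ltr0n.
have m0' : 0 < m%:R :> R by rewrite ltr0n.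
have [mn|nm|mn] := ltngtP m n; last first.
- by rewrite mn in m1 *; apply: block3_mono => //; exact: ltW.
- have : n%:R + 1 <= m%:R :> R by rewrite natr1 ler_nat.
  by move=> ?; exfalso; nra.
have le1 : block3 n%:R z <= block3 n%:R n%:R^-1.
  have [->//|zn] := eqVneq z n%:R^-1.
  apply/ltW/block3_mono => //; [|exact: ltW|by rewrite mulfV ?gt_eqF].
  by rewrite lt_neqAle zn -[leRHS]mul1r ler_pdivlMr // mulrC.
have lt2 : block3 m%:R (m%:R + 1)^-1 < block3 m%:R z'.
  have m10 : 0 < m%:R + 1 :> R by lra.
  apply: block3_mono => //; last by rewrite mulfV ?gt_eqF.
  by rewrite -[ltLHS]mul1r ltr_pdivrMr // mulrC.
apply: (le_lt_trans le1); apply: le_lt_trans lt2.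
rewrite block3V// block3V1//.
by rewrite ler_sqr ?nnegrE ?invr_ge0 ?ler0n// natr1 ?ler0n//
  lef_pV2 ?posrE ?ltr0n// ler_nat.
Qed.

Lemma blocks3_surj (R : realType) (y : R) : 0 < y <= 1 ->
  exists2 z : R, 0 < z <= 1 & blocks 3 z = y.
Proof.
move=> /andP[y0 y1].
have exn : exists n : nat, 1 < n.+1%:R ^+ 2 * y.
  exists (Num.truncn y^-1).
  have yV0 : 0 <= y^-1 by rewrite invr_ge0 ltW.
  have /andP[_ lt1] := truncn_itv yV0.
  rewrite -ltr_pdivrMr// div1r (lt_le_trans lt1)// expr2 ler_peMr ?ler0n//.
  by rewrite ler1n.
case: (ex_minnP exn) => -[|n] hn hmin.
  by move: hn; rewrite expr1n mul1r ltNge y1.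
have hn' : n.+1%:R ^+ 2 * y <= 1.
  by rewrite leNgt; apply/negP => lt1; have := hmin n lt1; rewrite ltnn.
set k : R := n.+1%:R in hn'.
have k1E : n.+2%:R = k + 1 :> R by rewrite /k natr1.
rewrite k1E in hn.
have k0 : 0 < k by rewrite ltr0n.
have k10 : 0 < k + 1 by lra.
have ya : block3 k (k + 1)^-1 < y.
  by rewrite block3V1// exprVn -[ltLHS]mul1r ltr_pdivrMr ?exprn_gt0// mulrC.
have yb : y <= block3 k k^-1.
  by rewrite block3V// exprVn -[leRHS]mul1r ler_pdivlMr ?exprn_gt0// mulrC.
pose q : {poly R} := k *: 'X^3 + (1 - k *: 'X) ^+ 3 - y%:P.
have qE z : q.[z] = block3 k z - y by rewrite /q /block3 !hornerE.
have [||z /andP[az zb]] := @poly_ivt R q (k + 1)^-1 k^-1.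
- by rewrite lef_pV2 ?posrE//; lra.
- by rewrite !qE subr_le0 (ltW ya) subr_ge0.
rewrite /root qE subr_eq0 => /eqP zE.
have z0 : 0 < z by apply: lt_le_trans az; rewrite invr_gt0.
exists z; first by rewrite z0 (le_trans zb)// invf_le1// /k ler1n.
suff fE : Num.floor z^-1 = n.+1%:Z :> int by rewrite /blocks fE -zE.
apply: floor_def; rewrite rmorphD /= -[n.+1%:~R]/k -[1%:~R]/(1 : R).
apply/andP; split; first by rewrite -[k]invrK lef_pV2 ?posrE ?invr_gt0.
rewrite -[k + 1]invrK ltf_pV2 ?posrE ?invr_gt0//.
rewrite lt_neqAle az andbT; apply/eqP => zz.
by move: ya; rewrite zz zE ltxx.
Qed.

Lemma g_funE (R : realType) (l : nat) (z : R) : 0 < z <= 1 ->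
  g_fun l (8^-1 * blocks 3 z) = (2 ^+ l)^-1 * blocks l z.
Proof.
move=> z01; rewrite /g_fun gt_eqF; last first.
  rewrite mulr_gt0 ?invr_gt0//.
  have [n nE [n0 n1 _]] := floorinv z01.
  have /andP[z0 _] := z01.
  rewrite /blocks nE ltr_wpDr// ?exprn_ge0 ?subr_ge0//.
  by rewrite mulr_gt0 ?exprn_gt0 ?ltr0n.
congr (_ * blocks l _).
case: xgetP => [w _ [/andP[w0 w1] /mulfI wz]|]; last by move/(_ z); case.
have {}wz : blocks 3 w = blocks 3 z by apply: wz; rewrite invr_eq0 pnatr_eq0.
have /andP[z0 z1] := z01.
have [wltz|zltw|//] := ltgtP w z.
- by have := blocks3_mono w0 wltz z1; rewrite wz ltxx.
- by have := blocks3_mono z0 zltw w1; rewrite wz ltxx.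
Qed.

(* Main.v *)
(** Let [A] be the adjacency matrix of a tournament on [n] vertices and let
    [N := (2 / n) (A + 1/2)], so that [N + N^T] is the constant matrix [2 / n].
    By Schur's theorem the eigenvalues [mu_j = a_j + i b_j] of [N] satisfy
    [a_j >= 0]; they sum to [1], and the sum of [mu_j ^ l] is
    [2 ^ l t(C_l)] up to [O(1 / n)].  When [t(C_3)] is close to [1/8] one
    eigenvalue [rho] is real and close to [1].  With [z] close to [1] and
    [z^3 + (1 - z)^3 = 8 t(C_3)] one gets [rho >= z], and convexity gives
    [rho^l - z^l >= K (rho^3 - z^3)] for [K := (l / 3) z^(l - 3)].  Every other
    eigenvalue satisfies [a^l - Re mu^l <= 3 K a b^2], because [a] is
    [O(1 / l^2)], [b^2 <= 1/2] and [Re (i b)^l >= 0] (this is where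
    [l <> 2 mod 4] enters).  Hence [K Re mu^3 - Re mu^l <= K a^3 - a^l], and
    summing over [mu <> rho] gives
    [sum mu_j^l >= z^l + (1 - z)^l = 2^l g_l (t(C_3))]. *)
Require Import Defs.
From mathcomp Require Import all_boot all_order all_algebra reals.
From mathcomp Require Import spectral mxred complex ring lra.

Set Implicit Arguments.
Unset Strict Implicit.
Unset Printing Implicit Defensive.

Import Order.TTheory GRing.Theory Num.Theory.
Local Open Scope ring_scope.

Local Notation Re := complex.Re.
Local Notation Im := complex.Im.

(** * Powers of complex numbers *)

Section ComplexPowers.
Variables (R : rcfType).
Implicit Types (x : R[i]) (a b r z : R).

Lemma ReXS x k : Re (x ^+ k.+1) = Re x * Re (x ^+ k) - Im x * Im (x ^+ k).
Proof. by rewrite exprS; case: (x ^+ k) => c d; case: x. Qed.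

Lemma ImXS x k : Im (x ^+ k.+1) = Re x * Im (x ^+ k) + Im x * Re (x ^+ k).
Proof. by rewrite exprS; case: (x ^+ k) => c d; case: x. Qed.

Lemma sqr_ReDIm_X x k :
  Re (x ^+ k) ^+ 2 + Im (x ^+ k) ^+ 2 = (Re x ^+ 2 + Im x ^+ 2) ^+ k.
Proof.
elim: k => [|k IHk]; first by rewrite !expr0 /= expr1n expr0n addr0.
by rewrite ReXS ImXS [RHS]exprS -IHk; ring.
Qed.

Variables (x : R[i]) (r : R).
Hypotheses (r_ge0 : 0 <= r) (rE : r ^+ 2 = Re x ^+ 2 + Im x ^+ 2).
Local Notation a := (Re x).
Local Notation b := (Im x).

Let norma_le : `|a| <= r.
Proof.
by rewrite -ler_sqr ?nnegrE // real_normK ?num_real // rE lerDl sqr_ge0.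
Qed.

Let normb_le : `|b| <= r.
Proof.
by rewrite -ler_sqr ?nnegrE // real_normK ?num_real // rE lerDr sqr_ge0.
Qed.

Lemma norm_ReX_le k : `|Re (x ^+ k)| <= r ^+ k.
Proof.
rewrite -ler_sqr ?nnegrE ?exprn_ge0 // real_normK ?num_real //.
by rewrite exprAC rE -sqr_ReDIm_X lerDl sqr_ge0.
Qed.

Lemma norm_ImX_le k : `|Im (x ^+ k)| <= r ^+ k.
Proof.
rewrite -ler_sqr ?nnegrE ?exprn_ge0 // real_normK ?num_real //.
by rewrite exprAC rE -sqr_ReDIm_X lerDr sqr_ge0.
Qed.

Lemma norm_ImXS_le k : `|Im (x ^+ k.+1)| <= k.+1%:R * `|b| * r ^+ k.
Proof.
elim: k => [|k IHk]; first by rewrite expr1 expr0 mul1r mulr1.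
rewrite ImXS (le_trans (ler_normD _ _)) // !normrM.
have -> : k.+2%:R * `|b| * r ^+ k.+1
    = r * (k.+1%:R * `|b| * r ^+ k) + `|b| * r ^+ k.+1.
  by rewrite -natr1 exprS; ring.
by rewrite lerD // ?ler_pM // norm_ReX_le.
Qed.

Local Notation y := (Complex 0 b).

Let ReyS k : Re (y ^+ k.+1) = - (b * Im (y ^+ k)).
Proof. by rewrite ReXS mul0r sub0r. Qed.

Let ImyS k : Im (y ^+ k.+1) = b * Re (y ^+ k).
Proof. by rewrite ImXS mul0r add0r. Qed.

Hypothesis a_ge0 : 0 <= a.

(* The induction goes two steps at a time: bounding real and imaginary parts
   alternately would lose a constant factor at each step. *)
Let norm_ReX_sub_le k : `|Re (x ^+ k) - Re (y ^+ k)| <= k%:R * a * r ^+ k.-1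
  /\ `|Re (x ^+ k.+1) - Re (y ^+ k.+1)| <= k.+1%:R * a * r ^+ k.
Proof.
elim: k => [|k [IH1 IH2]]; split => //.
- by rewrite !expr0 subrr normr0 !mul0r.
- by rewrite !expr1 expr0 subr0 mul1r mulr1 ger0_norm.
have -> : Re (x ^+ k.+2) - Re (y ^+ k.+2) =
    a * Re (x ^+ k.+1) - (a * (b * Im (x ^+ k)) +
      b ^+ 2 * (Re (x ^+ k) - Re (y ^+ k))).
  by rewrite ReXS ReyS ImXS ImyS; ring.
rewrite (le_trans (ler_normB _ _)) //.
have -> : k.+2%:R * a * r ^+ k.+1
    = a * r ^+ k.+1 + (a * r ^+ k.+1 + k%:R * a * r ^+ k.+1).
  by rewrite -addn2 natrD; ring.
rewrite lerD //.
  by rewrite normrM ger0_norm // ler_wpM2l // norm_ReX_le.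
rewrite (le_trans (ler_normD _ _)) // lerD //.
  by rewrite !normrM ger0_norm // ler_wpM2l // exprS ler_pM // norm_ImX_le.
case: k IH1 {IH2} => [|k] IH1.
  by rewrite !expr0 subrr mulr0 normr0 !mul0r.
have b2_le : `|b| ^+ 2 <= r ^+ 2 by rewrite ler_sqr ?nnegrE.
rewrite normrM normrX (le_trans (ler_pM _ _ b2_le IH1)) ?exprn_ge0 //=.
by rewrite le_eqVlt; apply/orP; left; apply/eqP; rewrite !exprS; ring.
Qed.

(** The bound vanishes with [a] as well as with [b]. Multiplied by [b] it supplies the factor
    [a * b ^+ 2] of [sub_ReX_le]. *)
Lemma norm_ImX_sub_le k :
  `|Im (x ^+ k.+2) - Im (y ^+ k.+2)| <= 2 * k.+1%:R * a * `|b| * r ^+ k.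
Proof.
have -> : Im (x ^+ k.+2) - Im (y ^+ k.+2) =
    a * Im (x ^+ k.+1) + b * (Re (x ^+ k.+1) - Re (y ^+ k.+1)).
  by rewrite ImXS ImyS; ring.
rewrite (le_trans (ler_normD _ _)) // !normrM (ger0_norm a_ge0).
have -> : 2 * k.+1%:R * a * `|b| * r ^+ k =
    a * (k.+1%:R * `|b| * r ^+ k) + `|b| * (k.+1%:R * a * r ^+ k) by ring.
by rewrite lerD // ler_wpM2l ?norm_ImXS_le //; case: (norm_ReX_sub_le k).
Qed.

Let ImyE k : b * Im (y ^+ (4 * k)) = 0 /\ Re (y ^+ (4 * k)) = b ^+ (4 * k).
Proof.
elim: k => [|k [IH1 IH2]]; first by rewrite muln0 !expr0 mulr0.
rewrite mulnS /= !(ReyS, ImyS) /=.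
move: (Im (y ^+ (4 * k))) (Re (y ^+ (4 * k))) IH1 IH2 => u v IH1 IH2.
split; last by rewrite IH2 (exprD _ 4); ring.
by rewrite [LHS](_ : _ = b ^+ 4 * (b * u)) ?IH1 ?mulr0 //; ring.
Qed.

(* As [Re (y ^ l) = - b Im (y ^ (l - 1))], this says that [(i b) ^ l] has
   nonnegative real part, which fails exactly when [l = 2 mod 4]. *)
Let Imy_le0 l : (0 < l)%N -> (l %% 4 != 2)%N -> b * Im (y ^+ l.-1) <= 0.
Proof.
case: l => // l _ /=; rewrite (divn_eq l 4) -addnS modnMDl mulnC.
have [E1 E2] := ImyE (l %/ 4).
have := ltn_pmod l (isT : 0 < 4)%N; case: (l %% 4)%N => [|[|[|[]]]] //= _ _.
- by rewrite addn0 E1.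
- by rewrite addn2 !(ReyS, ImyS) E1 oppr0 !mulr0.
- rewrite addn3 !(ReyS, ImyS) E2 !mulrN -!exprS oppr_le0.
  by rewrite exprn_even_ge0 //= oddM.
Qed.

(** The error is of second order in [b]: each step adds [b * Im (x ^+ k)], and [Im (x ^+ k)] is
    itself at most [k * |b|]. *)
Let abs_subReX k : r <= 1 -> `|a ^+ k - Re (x ^+ k)| <= k%:R ^+ 2 * b ^+ 2.
Proof.
move=> r_le1; elim: k => [|k IHk].
  by rewrite !expr0 subrr normr0 expr0n mul0r.
have -> : a ^+ k.+1 - Re (x ^+ k.+1)
    = a * (a ^+ k - Re (x ^+ k)) + b * Im (x ^+ k).
  by rewrite ReXS exprS; ring.
have a1 : a <= 1 by rewrite -(ger0_norm a_ge0) (le_trans norma_le).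
have h1 : `|Im (x ^+ k)| <= k%:R * `|b|.
  case: k {IHk} => [|k]; first by rewrite expr0 normr0 mul0r.
  rewrite (le_trans (norm_ImXS_le k)) // ler_piMr ?mulr_ge0 //.
  by rewrite exprn_ile1.
rewrite (le_trans (ler_normD _ _)) // !normrM (ger0_norm a_ge0).
have h2 : `|b| * `|Im (x ^+ k)| <= k%:R * b ^+ 2.
  rewrite -[b ^+ 2]real_normK ?num_real // expr2.
  by rewrite mulrCA ler_wpM2l.
have h3 : a * `|a ^+ k - Re (x ^+ k)| <= k%:R ^+ 2 * b ^+ 2.
  by rewrite (le_trans _ IHk) // ler_piMl.
rewrite (le_trans (lerD h3 h2)) // -mulrDl ler_wpM2r ?sqr_ge0 //.
by rewrite -natr1; have := ler0n R k; nra.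
Qed.

(** The part of the difference that survives at [a = 0] is [- Re (y ^+ l)]. It has the right sign by
    [Imy_le0], and all other terms carry a factor [a * b ^+ 2]. *)
Lemma sub_ReX_le l : r <= 1 -> (2 < l)%N -> (l %% 4 != 2)%N ->
  a ^+ l - Re (x ^+ l)
    <= a * b ^+ 2 * (l%:R ^+ 2 * a + 3 * (l%:R - 2) * r ^+ (l - 3)).
Proof.
move=> r_le1; case: l => [|[|[|k]]] // _ lmod.
rewrite !subSS subn0.
(* Unroll the recurrence for the real part twice, then add and subtract [b * Im (y ^+ k.+2)], the
   term of known sign. *)
have -> : a ^+ k.+3 - Re (x ^+ k.+3) = a * (a * (a ^+ k.+1 - Re (x ^+ k.+1))
     + b * Im (x ^+ k.+1)) + b * (Im (x ^+ k.+2) - Im (y ^+ k.+2))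
     + b * Im (y ^+ k.+2).
  by rewrite ReXS [Re (x ^+ k.+2)]ReXS !exprS; ring.
have h0 := Imy_le0 (isT : 0 < k.+3)%N lmod; rewrite /= in h0.
have bb : `|b| * `|b| = b ^+ 2 by rewrite -expr2 real_normK ?num_real.
have h1 : b * (Im (x ^+ k.+2) - Im (y ^+ k.+2))
    <= a * b ^+ 2 * (2 * k.+1%:R * r ^+ k).
  rewrite (le_trans (ler_norm _)) // normrM.
  apply: (le_trans (ler_wpM2l _ (norm_ImX_sub_le k))) => //.
  by rewrite -bb le_eqVlt; apply/orP; left; apply/eqP; ring.
have h2 : b * Im (x ^+ k.+1) <= b ^+ 2 * (k.+1%:R * r ^+ k).
  rewrite (le_trans (ler_norm _)) // normrM.
  apply: (le_trans (ler_wpM2l _ (norm_ImXS_le k))) => //.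
  by rewrite -bb le_eqVlt; apply/orP; left; apply/eqP; ring.
have h3 : a ^+ k.+1 - Re (x ^+ k.+1) <= k.+3%:R ^+ 2 * b ^+ 2.
  rewrite (le_trans (ler_norm _)) // (le_trans (abs_subReX _ r_le1)) //.
  by rewrite ler_wpM2r ?sqr_ge0 // ler_sqr ?nnegrE // ler_nat ltnS !leqW.
have kE : k.+3%:R - 2 = k.+1%:R :> R by rewrite -addn2 natrD addrK.
rewrite kE.
have {h2 h3} h4 : a * (a * (a ^+ k.+1 - Re (x ^+ k.+1)) + b * Im (x ^+ k.+1))
   <= a * (a * (k.+3%:R ^+ 2 * b ^+ 2) + b ^+ 2 * (k.+1%:R * r ^+ k)).
  by rewrite ler_wpM2l // lerD // ler_wpM2l.
apply: (le_trans (lerD (lerD h4 h1) h0)).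
by rewrite le_eqVlt; apply/orP; left; apply/eqP; ring.
Qed.

End ComplexPowers.

(** * Inequality for power sums of the spectrum *)

Section SpectralInequality.
Variable R : rcfType.
Implicit Types (x : R[i]) (a b z : R).

Lemma ReX2 x : Re (x ^+ 2) = Re x ^+ 2 - Im x ^+ 2.
Proof. by case: x. Qed.

Lemma ImX2 x : Im (x ^+ 2) = 2 * (Re x * Im x).
Proof. by rewrite mulr_natl mulr2n {2}mulrC; case: x. Qed.

(** The constant is chosen to match [K_ge] in [spectral_ineq], which gives
    [3 * K >= 85 / 100 * l]. *)
Lemma sub_ReX_le_mul x l : (3 < l)%N -> (l %% 4 != 2)%N ->
  0 <= Re x -> l%:R ^+ 2 * Re x <= 6 / 10 -> Im x ^+ 2 <= 1 / 2 ->
  Re x ^+ l - Re (x ^+ l) <= 85 / 100 * l%:R * (Re x * Im x ^+ 2).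
Proof.
move=> l_gt3 lmod a_ge0 a_small b_small.
have b2_ge0 := sqr_ge0 (Im x); have ab2_ge0 := mulr_ge0 a_ge0 b2_ge0.
(* For [l = 4] and [l = 5] the power of [r] is not small enough, so these cases are expanded
   exactly; [l = 6] is excluded modulo 4. *)
have [l_ge7|] := leqP 7 l; last first.
  case: l l_gt3 lmod a_small => [|[|[|[|[|[|[]]]]]]] // _ _ a_small _.
  - have -> : Re x ^+ 4 - Re (x ^+ 4)
        = 6 * Re x * (Re x * Im x ^+ 2) - Im x ^+ 4.
      by rewrite (exprM x 2 2) !(ReX2, ImX2); ring.
    have b4_ge0 : 0 <= Im x ^+ 4 by rewrite exprn_even_ge0.
    have : 6 * Re x * (Re x * Im x ^+ 2) <= 1 * (Re x * Im x ^+ 2).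
      by rewrite ler_wpM2r //; lra.
    by lra.
  have -> : Re x ^+ 5 - Re (x ^+ 5)
      = 10 * Re x ^+ 2 * (Re x * Im x ^+ 2) - 5 * Re x * Im x ^+ 4.
    by rewrite ReXS (exprM x 2 2) !(ReX2, ImX2); ring.
  have b4_ge0 : 0 <= Im x ^+ 4 by rewrite exprn_even_ge0.
  have ab4_ge0 := mulr_ge0 a_ge0 b4_ge0.
  have : 10 * Re x ^+ 2 * (Re x * Im x ^+ 2) <= 1 * (Re x * Im x ^+ 2).
    by rewrite ler_wpM2r //; nra.
  by lra.
have l7 : 7 <= l%:R :> R by rewrite ler_nat.
have a_le : Re x <= 6 / 490.
  have : 49 * Re x <= l%:R ^+ 2 * Re x by rewrite ler_wpM2r //; nra.
  by lra.
have s_ge0 : 0 <= Re x ^+ 2 + Im x ^+ 2 by rewrite addr_ge0 ?sqr_ge0.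
pose r : R := Num.sqrt (Re x ^+ 2 + Im x ^+ 2).
have r_ge0 : 0 <= r by rewrite sqrtr_ge0.
have rE : r ^+ 2 = Re x ^+ 2 + Im x ^+ 2 by rewrite sqr_sqrtr.
have r2_le : r ^+ 2 <= 51 / 100 by rewrite rE; nra.
have r_le1 : r <= 1 by nra.
apply: (le_trans (sub_ReX_le r_ge0 rE a_ge0 r_le1 (ltnW l_gt3) lmod)).
rewrite [leRHS]mulrC ler_wpM2l //.
(* As [l - 3 >= 4] and [r <= 1], the power is at most [r ^+ 4 <= (51 / 100) ^+ 2]. The final bound
   is then [6 / 10 + 81 / 100 * (l - 2)], below [85 / 100 * l]. *)
have r4_le : r ^+ (l - 3) <= 27 / 100.
  rewrite -(subnKC l_ge7) -[(7 + _)%N]/(3 + (4 + (l - 7)))%N addKn exprD.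
  rewrite (exprM r 2 2) (@le_trans _ _ ((r ^+ 2) ^+ 2 * 1)) //.
    by rewrite ler_wpM2l ?exprn_ge0 // exprn_ile1.
  have := ler_pM (sqr_ge0 r) (sqr_ge0 r) r2_le r2_le.
  by rewrite mulr1 -expr2; lra.
have : 3 * (l%:R - 2) * r ^+ (l - 3) <= 3 * (l%:R - 2) * (27 / 100) :> R.
  by rewrite ler_wpM2l //; lra.
by lra.
Qed.

(** This is the tangent line at [z ^+ 3] of the convex function [s ^ ((k + 3) / 3)], evaluated at
    [rho ^+ 3]. Induction on [k] avoids fractional exponents. *)
Lemma exprn_sub_ge z rho k : 0 <= z -> z <= rho ->
  (k%:R + 3) * z ^+ k * (rho ^+ 3 - z ^+ 3)
    <= 3 * (rho ^+ (k + 3) - z ^+ (k + 3)).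
Proof.
move=> z_ge0 z_le; elim: k => [|k IHk]; first by rewrite expr0; lra.
have rho_ge0 := le_trans z_ge0 z_le.
rewrite addSn (exprS rho (k + 3)) (exprS z (k + 3)) (exprS z k) -natr1.
have zk_ge0 : 0 <= z ^+ k by rewrite exprn_ge0.
have k_ge0 : 0 <= k%:R :> R by rewrite ler0n.
have h1 := ler_wpM2l rho_ge0 IHk.
have zk3 : z ^+ (k + 3) = z ^+ k * z ^+ 3 by rewrite exprD.
have -> : 3 * (rho * rho ^+ (k + 3) - z * z ^+ (k + 3)) =
   rho * (3 * (rho ^+ (k + 3) - z ^+ (k + 3)))
     + z ^+ k * (3 * z ^+ 3 * (rho - z)).
  by rewrite zk3; ring.
apply: le_trans (lerD h1 (lexx _)).
rewrite -subr_ge0.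
have -> : rho * ((k%:R + 3) * z ^+ k * (rho ^+ 3 - z ^+ 3)) +
   z ^+ k * (3 * z ^+ 3 * (rho - z)) -
   (k%:R + 1 + 3) * (z * z ^+ k) * (rho ^+ 3 - z ^+ 3) =
  z ^+ k * ((rho - z) * (k%:R * (rho ^+ 3 - z ^+ 3) +
     (3 * rho ^+ 3 - z * (rho ^+ 2 + rho * z + z ^+ 2)))) by ring.
have le3 : z ^+ 3 <= rho ^+ 3 by rewrite ler_pXn2r ?nnegrE.
have le2 : z ^+ 2 <= rho ^+ 2 by rewrite ler_pXn2r ?nnegrE.
have lezr : rho * z <= rho ^+ 2 by rewrite expr2 ler_wpM2l.
have h2 : z * (rho ^+ 2 + rho * z + z ^+ 2) <= rho * (3 * rho ^+ 2).
  apply: ler_pM => //; last by lra.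
  by rewrite !addr_ge0 ?sqr_ge0 // mulr_ge0.
rewrite mulr_ge0 // mulr_ge0 ?subr_ge0 // addr_ge0 //.
  by rewrite mulr_ge0 // subr_ge0.
have -> : 3 * rho ^+ 3 = rho * (3 * rho ^+ 2) by ring.
by rewrite subr_ge0.
Qed.

(** Mean value bound, with the derivative taken at the larger endpoint [z]. *)
Lemma exprn_sub_le a z k : 0 <= a -> a <= z ->
  z ^+ k.+1 - a ^+ k.+1 <= k.+1%:R * z ^+ k * (z - a).
Proof.
move=> a_ge0 a_le; elim: k => [|k IHk]; first by rewrite !expr1 expr0 !mul1r.
have z_ge0 := le_trans a_ge0 a_le.
have -> : z ^+ k.+2 - a ^+ k.+2
    = z * (z ^+ k.+1 - a ^+ k.+1) + a ^+ k.+1 * (z - a).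
  by rewrite (exprS _ k.+1) (exprS a k.+1); ring.
have h1 := ler_wpM2l z_ge0 IHk.
have h2 : a ^+ k.+1 * (z - a) <= z ^+ k.+1 * (z - a).
  by rewrite ler_wpM2r ?subr_ge0 // ler_pXn2r ?nnegrE.
apply: (le_trans (lerD h1 h2)).
by rewrite -[k.+2%:R]natr1 exprS; lra.
Qed.

Lemma sum_ge_pair (I : finType) (F : I -> R) (i j : I) :
  (forall k, 0 <= F k) -> i != j -> F i + F j <= \sum_k F k.
Proof.
move=> F_ge0 ij; rewrite (bigD1 i) //= lerD2l (bigD1 j) 1?eq_sym //=.
by rewrite lerDl sumr_ge0.
Qed.

Section Spectrum.
Variables (I : finType) (mu : I -> R[i]).
Hypothesis Re_ge0 : forall i, 0 <= Re (mu i).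
Hypothesis sum1 : \sum_i Re (mu i) = 1.
Hypothesis sum2 : 0 <= \sum_i Re (mu i ^+ 2).
Hypothesis conj_mu :
  forall i, exists j, mu j = Complex (Re (mu i)) (- Im (mu i)).

Let Re3E i :
  Re (mu i ^+ 3) = Re (mu i) ^+ 3 - 3 * (Re (mu i) * Im (mu i) ^+ 2).
Proof. by rewrite ReXS ReX2 ImX2; ring. Qed.

Let Re_le1 i : Re (mu i) <= 1.
Proof. by rewrite -sum1 (bigD1 i) //= lerDl sumr_ge0. Qed.

Let conj_partner i : Im (mu i) != 0 ->
  exists2 j, i != j & mu j = Complex (Re (mu i)) (- Im (mu i)).
Proof.
move=> b_neq0; have [j muj] := conj_mu i; exists j => //.
apply: contra b_neq0 => /eqP ij; move: muj; rewrite -ij.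
by case: (mu i) => a b /= [/eqP]; rewrite -addr_eq0 -mulr2n mulrn_eq0.
Qed.

(* Non-real eigenvalues come in pairs and [sum b_j^2 <= sum a_j^2 <= 1]. *)
Lemma sqr_Im_le_half i : Im (mu i) ^+ 2 <= 1 / 2.
Proof.
have [->|/conj_partner[j ij muj]] := eqVneq (Im (mu i)) 0.
  by rewrite expr0n /=; lra.
have := sum_ge_pair (fun k => sqr_ge0 (Im (mu k))) ij.
rewrite muj /= sqrrN.
have : \sum_k Im (mu k) ^+ 2 <= \sum_k Re (mu k) ^+ 2.
  by rewrite -subr_ge0 -sumrB; under eq_bigr do rewrite -ReX2.
have : \sum_k Re (mu k) ^+ 2 <= \sum_k Re (mu k).
  by apply: ler_sum => k _; rewrite expr2 ler_piMr.
by rewrite sum1; lra.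
Qed.

Let Re3_le i : Re (mu i ^+ 3) <= Re (mu i) ^+ 3.
Proof. by rewrite Re3E gerBl mulr_ge0 // mulr_ge0 // sqr_ge0. Qed.

Lemma sum_Re3_le1 : \sum_i Re (mu i ^+ 3) <= 1.
Proof.
rewrite -sum1; apply: ler_sum => i _; apply: le_trans (Re3_le i) _.
by rewrite exprS ler_piMr // exprn_ile1.
Qed.

(** Take the index of maximal real part: [Re (mu j ^+ 3) <= Re (mu j) ^+ 3 <= Re (mu i) ^+ 2 * Re
    (mu j)], and the real parts sum to 1. *)
Lemma dominant_Re : exists i, \sum_i Re (mu i ^+ 3) <= Re (mu i) ^+ 2.
Proof.
have [i0 _] : exists i0 : I, true.
  case: (pickP (@predT I)) => [i0 _|I0]; first by exists i0.
  by have := sum1; rewrite big_pred0 // => /eqP; rewrite eq_sym oner_eq0.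
case: (@arg_maxP _ _ _ i0 predT (fun i => Re (mu i)) isT) => i _ imax; exists i.
rewrite -[leRHS]mulr1 -sum1 mulr_sumr; apply: ler_sum => j _.
apply: le_trans (Re3_le j) _; rewrite exprSr ler_wpM2r //.
by rewrite ler_pXn2r ?nnegrE //; apply: imax.
Qed.

Theorem spectral_ineq l z : (3 < l)%N -> (l %% 4 != 2)%N ->
  1 / 2 < z <= 1 -> l%:R ^+ 2 * (1 - z) <= 6 / 10 ->
  z ^+ 3 + (1 - z) ^+ 3 <= \sum_i Re (mu i ^+ 3) ->
  z ^+ l + (1 - z) ^+ l <= \sum_i Re (mu i ^+ l).
Proof.
move=> l_gt3 lmod /andP[z_gt z_le1] z_small z_le.
have l4 : 4 <= l%:R :> R by rewrite ler_nat.
set w := 1 - z in z_small z_le *.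
have zE : z = 1 - w by rewrite /w; lra.
have w_ge0 : 0 <= w by rewrite subr_ge0.
have lw_le : l%:R * w <= 15 / 100.
  have : 4 * (l%:R * w) <= l%:R ^+ 2 * w.
    by rewrite expr2 -mulrA ler_wpM2r // mulr_ge0.
  by lra.
have w_le : w <= 15 / 400.
  have : 4 * w <= l%:R * w by rewrite ler_wpM2r.
  by lra.
have z_ge0 : 0 <= z by lra.
have [i rho3] := dominant_Re.
set rho := Re (mu i) in rho3.
have rho_ge0 : 0 <= rho := Re_ge0 i.
(* [z ^+ 3 + w ^+ 3 = 1 - 3 * z * w] is close to 1, whereas [rho <= 1 / 2] would bound it by
   [1 / 4]. *)
have rho_gt : 1 / 2 < rho.
  by rewrite ltNge; apply/negP => rho_le; move: z_le rho3; rewrite zE; nra.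
(* Otherwise the conjugate eigenvalue also has real part [rho], and the two exceed the total 1. *)
have Im0 : Im (mu i) = 0.
  apply/eqP; apply/negP => /negP /conj_partner[j ij muj].
  by have := sum_ge_pair Re_ge0 ij; rewrite muj /= sum1 -/rho; lra.
have ReXi k : Re (mu i ^+ k) = rho ^+ k.
  elim: k => [|k IHk]; first by rewrite !expr0.
  by rewrite ReXS IHk Im0 mul0r subr0 exprS.
have sumE : \sum_(j | j != i) Re (mu j) = 1 - rho.
  by apply/eqP; rewrite eq_sym subr_eq -sum1 (bigD1 i) //= addrC.
have Rej_le j : j != i -> Re (mu j) <= 1 - rho.
  by move=> ji; rewrite -sumE (bigD1 j) //= lerDl sumr_ge0.
have rho_le1 : rho <= 1 := Re_le1 i.
(* The other eigenvalues contribute at most [(1 - rho) ^+ 3] to the cubes, and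
   [s ^+ 3 + (1 - s) ^+ 3] increases on [[1/2, 1]]. *)
have z_le_rho : z <= rho.
  have : \sum_(j | j != i) Re (mu j ^+ 3) <= (1 - rho) ^+ 3.
    rewrite exprSr -[X in _ ^+ 2 * X]sumE mulr_sumr; apply: ler_sum => j ji.
    apply: le_trans (Re3_le j) _; rewrite exprSr ler_wpM2r //.
    by rewrite ler_pXn2r ?nnegrE ?subr_ge0 // Rej_le.
  move: z_le; rewrite (bigD1 i) //= ReXi leNgt => h1 h2; apply/negP => h3.
  suff : 0 < (z - rho) * (z + rho - 1) by move: h1 h2; rewrite /w; nra.
  by rewrite mulr_gt0 //; lra.
case: l l_gt3 lmod l4 z_small lw_le => [|[|[|[|k]]]] //.
move=> l_gt3 lmod l4 z_small lw_le.
pose K := k.+4%:R / 3 * z ^+ k.+1.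
(* Bernoulli: [z ^+ k.+1 >= 1 - (k + 1) * w >= 85 / 100]. *)
have K_ge : 85 / 300 * k.+4%:R <= K.
  have : 85 / 100 <= z ^+ k.+1.
    have := @exprn_sub_le z 1 k _ z_le1; rewrite !expr1n mulr1 -/w => bernoulli.
    have : k.+1%:R * w <= k.+4%:R * w.
      by rewrite ler_wpM2r // ler_nat ltnS !leqW.
    by have := bernoulli z_ge0; lra.
  have l3_ge0 : 0 <= k.+4%:R / 3 :> R by rewrite divr_ge0.
  by move/(ler_wpM2l l3_ge0); rewrite -/K; lra.
have K_ge1 : 1 <= K by lra.
have convex : K * (rho ^+ 3 - z ^+ 3) <= rho ^+ k.+4 - z ^+ k.+4.
  have := @exprn_sub_ge z rho k.+1 _ z_le_rho; rewrite addn3.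
  have -> : k.+1%:R + 3 = k.+4%:R :> R by rewrite -natrD addn3.
  by rewrite /K => h; have := h z_ge0; lra.
(* Writing [K * a ^+ 3 - a ^+ l] as [a] times an increasing factor, replace that factor by its value
   at [w]. The remaining sum of real parts is [1 - rho <= w]. *)
have factor_mono a : 0 <= a -> a <= w ->
    K * a ^+ 2 - a ^+ k.+3 <= K * w ^+ 2 - w ^+ k.+3.
  move=> a_ge0 a_le.
  have h1 := exprn_sub_le k.+2 a_ge0 a_le.
  have h2 : k.+3%:R * w ^+ k.+2 <= w.
    have wk : w ^+ k <= 1 by rewrite exprn_ile1 //; lra.
    have h3 : k.+3%:R * w <= 1.
      have : k.+3%:R * w <= k.+4%:R * w by rewrite ler_wpM2r // ler_nat.
      by lra.
    rewrite !exprS !mulrA -[leRHS]mulr1 ler_pM ?exprn_ge0 ?mulr_ge0 //.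
    by rewrite ler_piMl.
  have h4 : k.+3%:R * w ^+ k.+2 * (w - a) <= (w + a) * (w - a).
    by rewrite ler_wpM2r ?subr_ge0 //; lra.
  have h5 : 1 * (w ^+ 2 - a ^+ 2) <= K * (w ^+ 2 - a ^+ 2).
    by rewrite ler_wpM2r // subr_ge0 ler_pXn2r ?nnegrE.
  have : (w + a) * (w - a) = w ^+ 2 - a ^+ 2 by ring.
  by lra.
have term_le j : j != i -> K * Re (mu j ^+ 3) - Re (mu j ^+ k.+4)
    <= Re (mu j) * (K * w ^+ 2 - w ^+ k.+3).
  move=> ji; have a_ge0 := Re_ge0 j; have b2_ge0 := sqr_ge0 (Im (mu j)).
  have a_le : Re (mu j) <= w by have := Rej_le j ji; rewrite /w; lra.
  apply: le_trans (ler_wpM2l a_ge0 (factor_mono _ a_ge0 a_le)).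
  have := @sub_ReX_le_mul (mu j) k.+4 l_gt3 lmod a_ge0 _ (sqr_Im_le_half j).
  have a_small : k.+4%:R ^+ 2 * Re (mu j) <= 6 / 10.
    by apply: le_trans z_small; rewrite ler_wpM2l ?sqr_ge0.
  move=> /(_ a_small).
  have : 85 / 300 * k.+4%:R * (Re (mu j) * Im (mu j) ^+ 2)
      <= K * (Re (mu j) * Im (mu j) ^+ 2).
    exact: ler_wpM2r (mulr_ge0 a_ge0 b2_ge0) _ _ K_ge.
  have -> : Re (mu j) * (K * Re (mu j) ^+ 2 - Re (mu j) ^+ k.+3)
      = K * Re (mu j) ^+ 3 - Re (mu j) ^+ k.+4 by rewrite (exprS _ k.+3); ring.
  rewrite Re3E.
  by lra.
have sum_le : K * (\sum_(j | j != i) Re (mu j ^+ 3))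
    - \sum_(j | j != i) Re (mu j ^+ k.+4) <= K * w ^+ 3 - w ^+ k.+4.
  rewrite mulr_sumr -sumrB (le_trans (ler_sum _ term_le)) // -mulr_suml sumE.
  have f0 : 0 <= K * w ^+ 2 - w ^+ k.+3.
    by have := factor_mono 0 (lexx 0) w_ge0; rewrite !expr0n /= mulr0 subr0.
  have : (1 - rho) * (K * w ^+ 2 - w ^+ k.+3) <= w * (K * w ^+ 2 - w ^+ k.+3).
    by rewrite ler_wpM2r // /w; lra.
  rewrite (exprS w k.+3) [w * (_ - _)]mulrBr.
  by have -> : w * (K * w ^+ 2) = K * w ^+ 3 by ring.
rewrite (bigD1 i) //= ReXi; rewrite (bigD1 i) //= ReXi in z_le.
have : K * (z ^+ 3 + w ^+ 3)
    <= K * (rho ^+ 3 + \sum_(j | j != i) Re (mu j ^+ 3)).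
  by rewrite ler_wpM2l //; lra.
by move: sum_le convex; lra.
Qed.

End Spectrum.
End SpectralInequality.

(** * Spectrum of a real matrix *)

Lemma trig_mxX (F : comPzRingType) n (T : 'M[F]_n) k : is_trig_mx T ->
  is_trig_mx (T ^+ k) /\ forall i, (T ^+ k) i i = T i i ^+ k.
Proof.
move=> /is_trig_mxP T_trig; elim: k => [|k [/is_trig_mxP IH1 IH2]].
  by rewrite expr0; split=> [|i]; rewrite ?scalar_mx_is_trig // !mxE eqxx.
rewrite exprS; split=> [|i].
  apply/is_trig_mxP => i j ij; rewrite mxE big1 // => m _.
  have [im|mi] := ltnP i m; first by rewrite T_trig ?mul0r.
  by rewrite IH1 ?mulr0 // (leq_ltn_trans mi).
rewrite mxE (bigD1 i) //= big1 ?addr0 ?IH2 ?exprS // => m mi.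
have [im|im|/val_inj im] := ltngtP i m; first by rewrite T_trig ?mul0r.
  by rewrite IH1 ?mulr0.
by rewrite im eqxx in mi.
Qed.

Lemma eigenvalue_trig_mxP (F : fieldType) n (T : 'M[F]_n) a : is_trig_mx T ->
  reflect (exists i, T i i = a) (eigenvalue T a).
Proof.
move=> T_trig; rewrite eigenvalue_root_char char_poly_trig // rootE horner_prod.
apply: (iffP (@prodf_eq0 _ _ _ _)) => [[i _]|[i <-]]; last first.
  by exists i; rewrite // !hornerE subrr.
by rewrite !hornerE subr_eq0 => /eqP ->; exists i.
Qed.

Section RealMatrixSpectrum.
Local Open Scope sesquilinear_scope.
Variables (R : rcfType) (n : nat) (A : 'M[R]_n).
Hypothesis n_gt0 : (0 < n)%N.

Let toC : {rmorphism R -> R[i]} := real_complex R.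
Let B : 'M[R[i]]_n := map_mx toC A.

Let trBX k : \tr (B ^+ k) = toC (\tr (A ^+ k)).
Proof.
rewrite -trace_map_mx; congr (\tr _).
elim: k => [|k IHk]; first by rewrite !expr0 map_mx1.
by rewrite !exprS IHk map_mxM.
Qed.

Let conjB : B ^t* = map_mx toC A^T.
Proof.
apply/matrixP => i j; rewrite !mxE.
by apply/eqP; rewrite eq_complex /= oppr0 !eqxx.
Qed.

(** The [mu i] are the diagonal entries of a Schur triangularization [T], whose powers have the
    powers of these entries on the diagonal. *)
Theorem real_matrix_spectrum c : 0 <= c -> A + A^T = const_mx c ->
  exists mu : 'I_n -> R[i],
    [/\ forall i, 0 <= Re (mu i),
        forall i, exists j, mu j = Complex (Re (mu i)) (- Im (mu i)) &
        forall k, \tr (A ^+ k) = \sum_i Re (mu i ^+ k)].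
Proof.
move=> c_ge0 AE.
have [P P_unitary] := @Schur R[i] n B n_gt0.
have P_unit := unitarymx_unit P_unitary.
rewrite /similar_to conjymx //; set T := P *m B *m P^t* => T_trig.
have PPt : P *m P^t* = 1%:M by apply/unitarymxP.
have TX k : T ^+ k = P *m B ^+ k *m P^t*.
  elim: k => [|k IHk]; first by rewrite !expr0 mulmx1 PPt.
  rewrite !exprS IHk -!mulmxE /T -!mulmxA; congr (P *m (B *m _)).
  by rewrite mulmxA -invmx_unitary // mulVmx // mul1mx.
have TE : T = P *m B *m P^t* by [].
move: T TE T_trig TX => {}T TE T_trig TX.
exists (fun i => T i i); split.
- move=> i; have E : T + T^t* = P *m map_mx toC (const_mx c) *m P^t*.
    rewrite -AE map_mxD -conjB mulmxDr mulmxDl {1}TE; congr (_ + _).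
    rewrite TE !trmx_mul !map_mxM /= mulmxA; congr (_ *m _ *m _).
    by apply/matrixP => j k; rewrite !mxE conjCK.
  (* The constant matrix is [c] times the all-ones vector times its transpose, so with [u := P 1]
     twice the real part of [T i i] is [c * |u i| ^ 2]. *)
  have {E} [u E] : exists u : 'cV_n, T + T^t* = toC c *: (u *m u^t*).
    exists (P *m const_mx 1); rewrite E trmx_mul map_mxM /= !mulmxA scalemxAl.
    congr (_ *m _); rewrite -mulmxA scalemxAr; congr (_ *m _).
    by apply/matrixP => j k; rewrite !mxE big_ord1 !mxE rmorph1 !mulr1.
  have {E} : T i i + (T i i)^* = toC c * (u i 0 * (u i 0)^*).
    have -> : T i i + (T i i)^* = (T + T^t*) i i by rewrite !mxE.
    by rewrite E !mxE big_ord1 !mxE.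
  case: (T i i) (u i 0) => a b [x y] /(congr1 (@complex.Re R)) /= aE.
  have : 0 <= c * (x ^+ 2 + y ^+ 2) by rewrite mulr_ge0 // addr_ge0 ?sqr_ge0.
  by lra.
- move=> i.
  have /eigenvalueP[v vT v_neq0] : eigenvalue T (T i i).
    by apply/(eigenvalue_trig_mxP _ T_trig); exists i.
  have PtP : P^t* *m P = 1%:M by rewrite -invmx_unitary // mulVmx.
  have PtT : P^t* *m T = B *m P^t* by rewrite TE !mulmxA PtP mul1mx.
  have TP : T *m P = P *m B by rewrite TE mulmxKtV.
  (* Since [B] is real, conjugating its left eigenvector [v *m P] gives one for the conjugate
     eigenvalue; it is then carried back to [T]. *)
  pose w := map_mx Num.conj (v *m P).
  have wB : w *m B = (T i i)^* *: w.
    have -> : B = map_mx Num.conj B.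
      apply/matrixP => j k; rewrite !mxE.
      by apply/eqP; rewrite eq_complex /= oppr0 !eqxx.
    by rewrite -map_mxM -mulmxA -TP mulmxA vT -scalemxAl map_mxZ.
  have : eigenvalue T (T i i)^*.
    apply/eigenvalueP; exists (w *m P^t*).
      by rewrite -mulmxA PtT mulmxA wB scalemxAl.
    apply: contra v_neq0 => /eqP /(congr1 (fun M => M *m P)).
    rewrite mul0mx -mulmxA PtP mulmx1 => /eqP; rewrite map_mx_eq0.
    move=> /eqP /(congr1 (fun M => M *m P^t*)).
    by rewrite mul0mx -mulmxA PPt mulmx1 => /eqP.
  move=> /(eigenvalue_trig_mxP _ T_trig) [j Tj]; exists j; rewrite Tj.
  by case: (T i i).
move=> k; have : toC (\tr (A ^+ k)) = \sum_i T i i ^+ k.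
  rewrite -trBX; have [_ TXii] := trig_mxX k T_trig.
  under eq_bigr do rewrite -TXii; rewrite -/(\tr (T ^+ k)) TX.
  by rewrite mxtrace_mulC mulmxA -invmx_unitary // mulVmx // mul1mx.
move=> /(congr1 (@complex.Re R)) /= ->.
by rewrite (big_morph (@complex.Re R) (id1 := 0) (op1 := +%R)) // => -[? ?] [].
Qed.
End RealMatrixSpectrum.

(** * Closed walks in tournaments *)

Definition ffun_cons (V : finType) k (p : V * {ffun 'I_k -> V}) :
    {ffun 'I_k.+1 -> V} :=
  [ffun i => if unlift ord0 i is Some j then p.2 j else p.1].

Lemma ffun_cons0 (V : finType) k (p : V * {ffun 'I_k -> V}) :
  ffun_cons p ord0 = p.1.
Proof. by rewrite ffunE unlift_none. Qed.

Lemma ffun_consS (V : finType) k (p : V * {ffun 'I_k -> V}) i :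
  ffun_cons p (lift ord0 i) = p.2 i.
Proof. by rewrite ffunE liftK. Qed.

Lemma ffun_cons_bij (V : finType) k : bijective (@ffun_cons V k).
Proof.
exists (fun f : {ffun 'I_k.+1 -> V} => (f ord0, [ffun i => f (lift ord0 i)])).
  move=> [x g]; rewrite ffun_cons0; congr (_, _).
  by apply/ffunP => i; rewrite ffunE ffun_consS.
move=> f; apply/ffunP => i; rewrite ffunE.
by case: unliftP => [j|] ->; rewrite ?ffunE.
Qed.

Section ClosedWalks.
Variables (F : comPzRingType) (V : finType) (a : V -> V -> F).
Let A : 'M[F]_#|V| := \matrix_(i, j) a (enum_val i) (enum_val j).

Let sum_enum_val (G : V -> F) : \sum_x G x = \sum_(i < #|V|) G (enum_val i).
Proof.
rewrite (reindex (enum_val : 'I_#|V| -> V)) //.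
exact: onW_bij (enum_val_bij V).
Qed.

(** An arbitrary weight [G] on the two endpoints makes the induction work: on removing the first
    vertex, its arc is absorbed into a new weight. *)
Lemma sum_walks k (G : V -> V -> F) :
  \sum_(f : {ffun 'I_k.+1 -> V})
     (\prod_(i < k) a (f (widen_ord (leqnSn k) i)) (f (lift ord0 i)))
       * G (f ord0) (f ord_max)
  = \sum_i \sum_j (A ^+ k) i j * G (enum_val i) (enum_val j).
Proof.
elim: k G => [|k IHk] G.
  rewrite (reindex (fun x : V => [ffun _ : 'I_1 => x])) /=; last first.
    exists (fun f : {ffun 'I_1 -> V} => f ord0) => [x _|f _]; rewrite ?ffunE //.
    by apply/ffunP => i; rewrite ffunE (ord1 i).
  rewrite sum_enum_val.
  apply: eq_bigr => i _; rewrite big_ord0 mul1r !ffunE expr0.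
  rewrite (bigD1 i) //= big1 ?addr0 ?mxE ?eqxx ?mul1r // => j ji.
  by rewrite mxE eq_sym (negbTE ji) mul0r.
rewrite (reindex (@ffun_cons V k.+1)); last exact: onW_bij (ffun_cons_bij _ _).
rewrite -(pair_big predT predT (fun x g => (\prod_(i < k.+1)
    a (ffun_cons (x, g) (widen_ord (leqnSn k.+1) i))
      (ffun_cons (x, g) (lift ord0 i)))
  * G (ffun_cons (x, g) ord0) (ffun_cons (x, g) ord_max))) /=.
rewrite exchange_big /=.
pose G' y z := \sum_x a x y * G x z.
transitivity (\sum_(g : {ffun 'I_k.+1 -> V})
     (\prod_(i < k) a (g (widen_ord (leqnSn k) i)) (g (lift ord0 i)))
       * G' (g ord0) (g ord_max)).
  apply: eq_bigr => g _; rewrite /G' mulr_sumr; apply: eq_bigr => x _.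
  have -> : ord_max = lift ord0 ord_max :> 'I_k.+2 by apply: val_inj.
  rewrite big_ord_recl.
  have -> : widen_ord (leqnSn k.+1) ord0 = ord0 by apply: val_inj.
  rewrite ffun_cons0 !ffun_consS /= mulrA; congr (_ * _); rewrite mulrC.
  congr (_ * _); apply: eq_bigr => i _.
  have -> : widen_ord (leqnSn k.+1) (lift ord0 i)
      = lift ord0 (widen_ord (leqnSn k) i) by apply: val_inj.
  by rewrite !ffun_consS.
rewrite {}IHk exchange_big [RHS]exchange_big /=; apply: eq_bigr => j _.
rewrite /G'; under eq_bigr do rewrite sum_enum_val mulr_sumr.
rewrite exchange_big /=; apply: eq_bigr => i _.
rewrite exprS mxE mulr_suml; apply: eq_bigr => m _.
by rewrite mxE; ring.
Qed.

Lemma sum_closed_walks k :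
  \sum_(f : {ffun 'I_k.+1 -> V}) \prod_i a (f i) (f (ordS i)) = \tr (A ^+ k.+1).
Proof.
(* Only the last arc wraps around under [ordS]; it becomes the endpoint weight [G x y := a y x]. *)
transitivity (\sum_(f : {ffun 'I_k.+1 -> V})
     (\prod_(i < k) a (f (widen_ord (leqnSn k) i)) (f (lift ord0 i)))
       * a (f ord_max) (f ord0)).
  apply: eq_bigr => f _; rewrite big_ord_recr /=; congr (_ * _).
    apply: eq_bigr => i _; congr (a (f _) (f _)); apply: val_inj => //=.
    by rewrite modn_small // ltnS.
  by congr (a _ (f _)); apply: val_inj; rewrite /= modnn.
rewrite (sum_walks k (fun x y => a y x)) /mxtrace; apply: eq_bigr => i _.
by rewrite exprSr mxE; apply: eq_bigr => j _; rewrite mxE.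
Qed.

End ClosedWalks.

Definition adjmx (F : pzRingType) (V : finType) (e : rel V) : 'M[F]_#|V| :=
  \matrix_(i, j) (e (enum_val i) (enum_val j))%:R.

Lemma card_cycle_homs (F : comPzRingType) (V : finType) (e : rel V) l :
  (0 < l)%N -> #|cycle_homs l e|%:R = \tr (adjmx F e ^+ l).
Proof.
case: l => // k _.
rewrite -(sum_closed_walks (fun x y => (e x y)%:R : F)) -sum1_card natr_sum.
rewrite [RHS](bigID (mem (cycle_homs k.+1 e))) /= [X in _ + X]big1 ?addr0.
  apply: eq_bigr => f; rewrite inE => /forallP fP.
  by rewrite big1 // => i _; rewrite fP.
move=> f; rewrite inE => /forallPn[i /negbTE ei].
by rewrite (bigD1 i) //= ei mul0r.
Qed.

(** * Entrywise bounds for matrix powers *)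

Section EntryBounds.
Variables (R : realFieldType) (n : nat).
Implicit Types X Y : 'M[R]_n.

Definition entries_in a X := forall i j, 0 <= X i j <= a.

Lemma entries_inM a b X Y : entries_in a X -> entries_in b Y ->
  entries_in (n%:R * (a * b)) (X * Y).
Proof.
move=> Xa Yb i j; rewrite mxE; apply/andP; split.
  by apply: sumr_ge0 => k _; have /andP[? _] := Xa i k;
     have /andP[? _] := Yb k j; rewrite mulr_ge0.
apply: (@le_trans _ _ (\sum_(k < n) a * b)).
  by apply: ler_sum => k _; have /andP[? ?] := Xa i k;
     have /andP[? ?] := Yb k j; rewrite ler_pM.
by rewrite sumr_const card_ord mulr_natl.
Qed.

Lemma entries_inD a b X Y : entries_in a X -> entries_in b Y ->
  entries_in (a + b) (X + Y).
Proof.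
move=> Xa Yb i j; rewrite mxE; have /andP[? ?] := Xa i j.
by have /andP[? ?] := Yb i j; rewrite addr_ge0 // lerD.
Qed.

Lemma entries_in_le a b X : a <= b -> entries_in a X -> entries_in b X.
Proof. by move=> ab Xa i j; have /andP[-> /le_trans->] := Xa i j. Qed.

Lemma entries_in_tr a X : entries_in a X -> 0 <= \tr X <= n%:R * a.
Proof.
move=> Xa; rewrite /mxtrace sumr_ge0 /=; last first.
  by move=> i _; have /andP[] := Xa i i.
apply: (@le_trans _ _ (\sum_(k < n) a)).
  by apply: ler_sum => i _; have /andP[] := Xa i i.
by rewrite sumr_const card_ord mulr_natl.
Qed.

Lemma entries_inX X k : entries_in 1 X -> entries_in (n%:R ^+ k) (X ^+ k.+1).
Proof.
move=> X1; elim: k => [|k IHk]; first by rewrite expr1 expr0.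
by rewrite (exprS X) (exprS n%:R) -[n%:R ^+ k]mul1r; apply: entries_inM.
Qed.

Lemma entries_inZ c a X : 0 <= c -> entries_in a X ->
  entries_in (c * a) (c *: X).
Proof.
move=> c_ge0 Xa i j; rewrite mxE; have /andP[? ?] := Xa i j.
by rewrite mulr_ge0 // ler_wpM2l.
Qed.

(** Each step multiplies the bound by [n] and adds half a power of [X], so the difference is smaller
    than the powers themselves by a factor of order [n]. The claim starts at squares because [Y - X]
    has entries [1 / 2] on the diagonal. *)
Lemma entries_in_subX X Y k : entries_in 1 X -> entries_in 1 Y ->
  Y = X + (1 / 2)%:M ->
  entries_in (k.+2%:R * n%:R ^+ k) (Y ^+ k.+2 - X ^+ k.+2).
Proof.
move=> X1 Y1 YE; have h_ge0 : 0 <= 1 / 2 :> R by lra.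
have stepE m : Y ^+ m.+1 - X ^+ m.+1
    = Y * (Y ^+ m - X ^+ m) + (1 / 2) *: X ^+ m.
  rewrite -mul_scalar_mx mulmxE mulrBr -!exprS -addrA; congr (_ + _).
  by rewrite [in RHS]YE mulrDl opprD -exprS addrNK.
elim: k => [|k IHk]; rewrite stepE.
  have -> : Y ^+ 1 - X ^+ 1 = (1 / 2)%:M by rewrite !expr1 YE addrC addKr.
  rewrite -mulmxE mul_mx_scalar expr1 expr0.
  apply: entries_in_le
    (entries_inD (entries_inZ h_ge0 Y1) (entries_inZ h_ge0 X1)).
  by lra.
apply: entries_in_le
  (entries_inD (entries_inM Y1 IHk) (entries_inZ h_ge0 (entries_inX k.+1 X1))).
have := exprn_ge0 k.+1 (ler0n R n); rewrite -[k.+3%:R]natr1 exprS; nra.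
Qed.

Lemma exprZmx (c : R) X k : (c *: X) ^+ k = c ^+ k *: X ^+ k.
Proof.
elim: k => [|k IHk]; first by rewrite !expr0 scale1r.
by rewrite !exprS IHk -mulmxE -scalemxAl -scalemxAr scalerA.
Qed.

End EntryBounds.

(** * The shifted adjacency matrix of a tournament *)

Section TournamentMatrix.
Variables (R : realFieldType) (V : finType) (e : rel V).
Hypothesis e_tour : tournament e.
Local Notation n := #|V|.
Local Notation A := (adjmx R e).

Definition tourmx : 'M[R]_n := A + (1 / 2)%:M.

Lemma adjmx_in : entries_in 1 A.
Proof. by move=> i j; rewrite mxE ler0n lern1 leq_b1. Qed.

Lemma adjmx_diag i : A i i = 0.
Proof. by have [irr _] := e_tour; rewrite mxE irr. Qed.

Lemma tourmx_in : entries_in 1 tourmx.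
Proof.
move=> i j; rewrite mxE; have /andP[A0 A1] := adjmx_in i j.
rewrite [_%:M i j]mxE.
case: eqP A0 A1 => [->|_] A0 A1; rewrite ?adjmx_diag /= ?mulr1n ?mulr0n; lra.
Qed.

Lemma tourmxDT : tourmx + tourmx^T = const_mx 1.
Proof.
have [irr tot] := e_tour; apply/matrixP => i j.
rewrite !mxE [j == i]eq_sym; case: eqVneq => [->|ij].
  by rewrite irr /= mulr0n mulr1n; lra.
have /tot : enum_val i != enum_val j by rewrite (inj_eq enum_val_inj).
by case: (e _ _) (e _ _) => -[] //= _; rewrite ?mulr0n ?mulr1n; lra.
Qed.

Lemma tr_tourmx : \tr tourmx = n%:R / 2.
Proof.
rewrite mxtraceD mxtrace_scalar /mxtrace big1 => [|i _]; last exact: adjmx_diag.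
by rewrite add0r -mulr_natl; lra.
Qed.

(** The lower bound carries [t(C_3)] over to the spectrum without loss; the upper bound is the error
    paid for [t(C_l)]. *)
Lemma tr_tourmxX_bounds k :
  0 <= \tr (tourmx ^+ k.+2) - \tr (A ^+ k.+2) <= k.+2%:R * n%:R ^+ k.+1.
Proof.
have := entries_in_tr (entries_in_subX k adjmx_in tourmx_in erefl).
by rewrite raddfB /= mulrCA -exprS.
Qed.

End TournamentMatrix.

(** * From spectral sums to cycle densities *)

Lemma cycle_densityE (R : realType) (V : finType) (e : rel V) l : (0 < l)%N ->
  cycle_density R l e = \tr (adjmx R e ^+ l) / #|V|%:R ^+ l.
Proof. by move=> l_gt0; rewrite /cycle_density (card_cycle_homs R). Qed.

(** If [t], the floor of [z^-1], is at least 2, then [1 - t * z <= z] gives [blocks 3 z <= z ^+ 2 *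
    (t * z + (1 - t * z)) = z ^+ 2 <= 1 / 4]. So the floor is 1. *)
Lemma blocks_gt_quarter (R : realType) (z : R) :
  0 < z <= 1 -> 1 / 4 < blocks 3 z ->
  1 / 2 < z /\ forall l, blocks l z = z ^+ l + (1 - z) ^+ l.
Proof.
move=> z01; have /andP[z_gt0 _] := z01; rewrite /blocks.
have [[|[|m]] -> [// _ mz zm]] := floorinv z01.
  by move=> _; split=> [|l]; rewrite ?mul1r //; lra.
have m_ge2 : 2 <= m.+2%:R :> R by rewrite ler_nat.
rewrite -[m.+2%:~R]/(m.+2%:R); set t := m.+2%:R in mz zm m_ge2 *.
have z_le : z <= 1 / 2.
  have : 2 * z <= t * z by rewrite ler_wpM2r // ltW.
  by lra.
have w_le : (1 - t * z) ^+ 3 <= z ^+ 2 * (1 - t * z).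
  by rewrite exprSr ler_wpM2r ?ler_pXn2r ?nnegrE ?subr_ge0 //; lra.
have : z ^+ 2 <= (1 / 2) ^+ 2 by rewrite ler_pXn2r ?nnegrE //; lra.
rewrite !exprS expr0 !mulr1 in w_le *; lra.
Qed.

Theorem theorem1p3 (R : realType) (l : nat) (l_ge4 : (4 <= l)%N)
    (l_mod4 : (l <> 2 %[mod 4])%N) (eps : R) (eps_gt0 : 0 < eps) :
  exists n0 : nat, forall (V : finType) (e : rel V),
    tournament e -> (n0 <= #|V|)%N ->
    8^-1 - (10 * l%:R ^+ 2)^-1 <= cycle_density R 3 e ->
    g_fun l (cycle_density R 3 e) - eps <= cycle_density R l e.
Proof.
(* This makes [l / n <= eps], where [l / n] bounds the cost of the diagonal shift. *)
exists (Num.truncn (l%:R / eps)).+1 => V e e_tour n_ge.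
have n_gt0 : (0 < #|V|)%N by exact: leq_ltn_trans n_ge.
have nR_gt0 : 0 < #|V|%:R :> R by rewrite ltr0n.
have leps : l%:R / #|V|%:R <= eps.
  have q_ge0 : 0 <= l%:R / eps by rewrite divr_ge0 // ltW.
  rewrite ler_pdivrMr // mulrC -ler_pdivrMr //.
  have /andP[_ /ltW /le_trans->] // := truncn_itv q_ge0.
  by rewrite ler_nat.
rewrite !cycle_densityE //; last exact: ltn_trans l_ge4.
set n : R := #|V|%:R in nR_gt0 leps *; set A := adjmx R e.
pose M := tourmx R e.
have c_ge0 : 0 <= 2 / n by rewrite divr_ge0 // ltW.
have NE : (2 / n) *: M + ((2 / n) *: M)^T = const_mx (2 / n).
  rewrite linearZ /= -scalerDr tourmxDT //.
  by apply/matrixP => i j; rewrite !mxE mulr1.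
have [mu [Re_ge0 conj_mu muX]] := real_matrix_spectrum n_gt0 c_ge0 NE.
have {}muX k : \sum_i Re (mu i ^+ k) = 2 ^+ k * (\tr (M ^+ k) / n ^+ k).
  by rewrite -muX exprZmx mxtraceZ expr_div_n mulrAC mulrA.
have sum1 : \sum_i Re (mu i) = 1.
  have := muX 1%N; under eq_bigr do rewrite expr1.
  move=> ->; rewrite !expr1 tr_tourmx // -/n.
  by field; rewrite gt_eqF.
have trX k := tr_tourmxX_bounds R e_tour k; rewrite -/M -/A -/n in trX.
have trA_ge0 k : 0 <= \tr (A ^+ k.+1).
  by have /andP[] := entries_in_tr (entries_inX k (adjmx_in R e)).
have sum2 : 0 <= \sum_i Re (mu i ^+ 2).
  rewrite muX mulr_ge0 ?sqr_ge0 // divr_ge0 ?sqr_ge0 //.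
  by have := trX 0%N; have := trA_ge0 1%N; lra.
set t3 := \tr (A ^+ 3) / n ^+ 3 => t3_ge.
have t3_le : 8 * t3 <= \sum_i Re (mu i ^+ 3).
  rewrite muX -[8]/(8%:R) (_ : 8%:R = 2 ^+ 3); last by ring.
  rewrite ler_pM2l ?exprn_gt0 // ler_pM2r ?invr_gt0 ?exprn_gt0 //.
  by have := trX 1%N; lra.
have t3_le1 : 8 * t3 <= 1 by apply: le_trans t3_le (sum_Re3_le1 Re_ge0 sum1).
have l4 : 4 <= l%:R :> R by rewrite ler_nat.
have l_neq0 : l%:R != 0 :> R by rewrite gt_eqF //; lra.
have l2_ge : 16 <= l%:R ^+ 2 :> R by nra.
have l2_gt0 : 0 < l%:R ^+ 2 :> R by lra.
have [t3_pos l2t3] : 95 / 100 <= 8 * t3 /\ l%:R ^+ 2 * (1 - 8 * t3) <= 8 / 10.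
  have h : l%:R ^+ 2 * (1 - 8 * t3) <= 8 / 10.
    have := ler_wpM2l (ltW l2_gt0) t3_ge.
    have -> : l%:R ^+ 2 * (8^-1 - (10 * l%:R ^+ 2)^-1)
       = l%:R ^+ 2 * 8^-1 - 10^-1 :> R by field.
    by lra.
  split=> //; have : 16 * (1 - 8 * t3) <= l%:R ^+ 2 * (1 - 8 * t3).
    by rewrite ler_wpM2r //; lra.
  by lra.
have [z z01 zE] : exists2 z : R, 0 < z <= 1 & blocks 3 z = 8 * t3.
  by apply: blocks3_surj; lra.
have [|z_gt blocksE] := blocks_gt_quarter z01; first by rewrite zE; lra.
have -> : t3 = 8^-1 * blocks 3 z by rewrite zE; field.
rewrite g_funE // blocksE.
rewrite blocksE in zE.
have /andP[_ z_le1] := z01.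
have cubes : z ^+ 3 + (1 - z) ^+ 3 = 1 - 3 * (z * (1 - z)) by ring.
(* From [3 * z * (1 - z) = 1 - 8 * t3] and [z > 1 / 2] one gets [l ^ 2 * (1 - z) <= 8 / 15]. *)
have z_small : l%:R ^+ 2 * (1 - z) <= 6 / 10.
  have : 1 / 2 * (l%:R ^+ 2 * (1 - z)) <= z * (l%:R ^+ 2 * (1 - z)).
    by rewrite ler_wpM2r ?mulr_ge0 ?subr_ge0 // ltW.
  by move: l2t3; rewrite -zE cubes; lra.
have l_mod : (l %% 4 != 2)%N by apply/eqP.
have z_le_sum : z ^+ 3 + (1 - z) ^+ 3 <= \sum_i Re (mu i ^+ 3) by rewrite zE.
have z_bnd : 1 / 2 < z <= 1 by rewrite z_gt.
have := spectral_ineq Re_ge0 sum1 sum2 conj_mu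
  l_ge4 l_mod z_bnd z_small z_le_sum.
rewrite muX -ler_pdivrMl ?exprn_gt0 // => main.
(* Replacing [M] by [A] changes the trace by at most [l * n ^ (l - 1)], hence the density by at most
   [l / n]. *)
rewrite lerBlDr (le_trans main) // -lerBlDl -mulrBl (le_trans _ leps) //.
clear n_ge l_mod4 leps t3_ge l4 l_neq0 l2_ge l2_gt0 l2t3 z_small l_mod main.
case: l l_ge4 => [|[|k]] // _.
have /andP[_ trk] := trX k.
rewrite ler_pdivrMr ?exprn_gt0 // (le_trans trk) //.
by rewrite (exprS n k.+1) mulrA divfK // gt_eqF.
Qed.
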